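(* Let $q$ be a prime power. If there exist $\alpha_1,\alpha_2,\ldots,\alpha_6\in\mathbb{F}_{q^3}^*$ such that $$\det\begin{pmatrix} \alpha_1^2 & \alpha_2^2 & \alpha_3^2 & \alpha_4^2 & \alpha_5^2 & \alpha_6^2\\ \alpha_1^{2q} & \alpha_2^{2q} & \alpha_3^{2q} & \alpha_4^{2q} & \alpha_5^{2q} & \alpha_6^{2q}\\ \alpha_1^{2q^2} & \alpha_2^{2q^2} & \alpha_3^{2q^2} & \alpha_4^{2q^2} & \alpha_5^{2q^2} & \alpha_6^{2q^2}\\ \alpha_1^{q+1} & \alpha_2^{q+1} & \alpha_3^{q+1} & \alpha_4^{q+1} & \alpha_5^{q+1} & \alpha_6^{q+1}\\ \alpha_1^{q^2+q} & \alpha_2^{q^2+q} & \alpha_3^{q^2+q} & \alpha_4^{q^2+q} & \alpha_5^{q^2+q} & \alpha_6^{q^2+q}\\ \alpha_1^{q^2+1} & \alpha_2^{q^2+1} & \alpha_3^{q^2+1} & \alpha_4^{q^2+1} & \alpha_5^{q^2+1} & \alpha_6^{q^2+1} \end{pmatrix}\neq 0,$$ then $\mu_q^{\mathrm{sym}}(3)\leq 6$. Moreover, the elements $\alpha_1,\ldots,\alpha_6$ define a symmetric tensor decomposition of $M_{q^3}$, namely $$\langle x\rangle_{\mathbb{F}_{q^3}}\subseteq\left\langle\alpha_1\operatorname{Tr}_{q^3/q}(\alpha_1x),\ldots,\alpha_6\operatorname{Tr}_{q^3/q}(\alpha_6x)\right\rangle_{\mathbb{F}_q}.$$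
   Context: For a positive integer $m$, the symmetric tensor rank $\mu_q^{\mathrm{sym}}(m)$ of the multiplication map $M_{q^m}:\mathbb{F}_{q^m}\times\mathbb{F}_{q^m}\to\mathbb{F}_{q^m}$, $(\alpha,\beta)\mapsto\alpha\beta$, is the smallest integer $R$ for which there exist $\mathbb{F}_q$-linear forms $\phi_1,\ldots,\phi_R:\mathbb{F}_{q^m}\to\mathbb{F}_q$ and elements $w_1,\ldots,w_R\in\mathbb{F}_{q^m}$ with $\alpha\beta=\sum_{i=1}^R\phi_i(\alpha)\phi_i(\beta)w_i$ for all $\alpha,\beta\in\mathbb{F}_{q^m}$. $\operatorname{Tr}_{q^m/q}(x)=\sum_{j=0}^{m-1}x^{q^j}$ is the field trace. Linearized polynomials $\sum_{i=0}^{m-1}a_ix^{q^i}$ with $a_i\in\mathbb{F}_{q^m}$ (taken modulo $x^{q^m}-x$) are identified with $\mathbb{F}_q$-linear maps on $\mathbb{F}_{q^m}$, and $\langle x\rangle_{\mathbb{F}_{q^m}}=\{ax:a\in\mathbb{F}_{q^m}\}$; $\langle\cdots\rangle_{\mathbb{F}_q}$ denotes $\mathbb{F}_q$-linear span. *)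

(* Defs.v *)
From HB Require Import structures.
From mathcomp Require Import all_boot all_algebra all_field.
From mathcomp Require Import boolp ring.

Set Implicit Arguments.
Unset Strict Implicit.
Unset Printing Implicit Defensive.

Import GRing.Theory.
Local Open Scope ring_scope.

(* Throughout, F stands for F_q with q = #|F|, and L for F_{q^m} with
   m = \dim {:L}. *)

Section FieldTrace.
Variables (F : finFieldType) (L : fieldExtType F).

(* The trace from L to F, as the element \sum_(j < m) x^(q^j) of L (it lies
   in the copy 1%VS of F inside L). *)
Definition field_trace (x : L) : L :=
  \sum_(j < \dim {:L}) x ^+ (#|F| ^ j).

Definition scaled_trace (alpha x : L) : L := alpha * field_trace (alpha * x).

Lemma expr_card_linear j : linear (fun x : L => x ^+ (#|F| ^ j)).
Proof.
move=> a x y; have [p p_pr pcharFp] := finPcharP F.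
have pcharLp : p \in [pchar L] by rewrite pchar_lalg.
rewrite exprDn_pchar; last first.
  rewrite pnatX (card_pprimeChar pcharFp) pnatX; apply/orP; left.
  by apply/orP; left; rewrite pnatE.
rewrite exprZn; congr (_ *: _ + _).
by elim: j => [|j IHj]; rewrite ?expr1 // expnS exprM expf_card.
Qed.

Lemma scaled_trace_is_linear alpha : linear (scaled_trace alpha).
Proof.
move=> a x y; rewrite /scaled_trace /field_trace scalerAr -mulrDr; congr (_ * _).
rewrite scaler_sumr -big_split; apply: eq_bigr => j _ /=.
by rewrite mulrDr -scalerAr expr_card_linear.
Qed.

HB.instance Definition _ alpha :=
  GRing.isLinear.Build F L L *:%R (scaled_trace alpha)
    (scaled_trace_is_linear alpha).

(* Linearized polynomials modulo x^(q^m) - x are identified with elements of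
   'End(L).  The next one is alpha Tr(alpha x). *)
Definition trace_map (alpha : L) : 'End(L) := linfun (scaled_trace alpha).

Lemma trace_mapE alpha x :
  trace_map alpha x = alpha * \sum_(j < \dim {:L}) (alpha * x) ^+ (#|F| ^ j).
Proof. by rewrite lfunE. Qed.

(* <x>_L = {a x : a in L}, as a subspace over F of the linearized polynomials *)
Definition Lspan_x : {vspace 'End(L)} := limg (linfun (@amull F L)).

Lemma Lspan_xP (f : 'End(L)) :
  reflect (exists a : L, forall x, f x = a * x) (f \in Lspan_x).
Proof.
apply: (iffP memv_imgP) => [[a _ ->]|[a fE]]; exists a.
- by move=> x; rewrite !lfunE.
- exact: memvf.
- by apply/lfunP => x; rewrite fE !lfunE.
Qed.

End FieldTrace.

Section SymmetricTensorRank.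
Variables (F : finFieldType) (L : fieldExtType F).

Definition sym_decomposition (R : nat)
    (phi : 'I_R -> 'Hom(L, F^o)) (w : 'I_R -> L) : Prop :=
  forall a b : L, a * b = \sum_(i < R) (phi i a * phi i b) *: w i.

Definition has_sym_decomposition (R : nat) : Prop :=
  exists (phi : 'I_R -> 'Hom(L, F^o)) (w : 'I_R -> L), sym_decomposition phi w.

Let sym_sum (B : L -> L -> L) : Prop :=
  exists s : seq ('Hom(L, F^o) * L),
    forall a b, B a b = \sum_(t <- s) (t.1 a * t.1 b) *: t.2.

Let sym_sum0 : sym_sum (fun _ _ => 0).
Proof. by exists [::] => a b; rewrite big_nil. Qed.

Let sym_sumD B C :
  sym_sum B -> sym_sum C -> sym_sum (fun a b => B a b + C a b).
Proof.
by move=> [s sP] [t tP]; exists (s ++ t) => a b; rewrite big_cat sP tP.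
Qed.

Let sym_sum_ext B C : (forall a b, B a b = C a b) -> sym_sum B -> sym_sum C.
Proof. by move=> eqBC [s sP]; exists s => a b; rewrite -eqBC. Qed.

Let sym_sum_big (I : Type) (r : seq I) (P : pred I) (B : I -> L -> L -> L) :
  (forall i, P i -> sym_sum (B i)) ->
  sym_sum (fun a b => \sum_(i <- r | P i) B i a b).
Proof.
move=> sB; elim: r => [|i r IHr].
  by apply: sym_sum_ext sym_sum0 => a b; rewrite big_nil.
case Pi: (P i); last by apply: sym_sum_ext IHr => a b; rewrite big_cons Pi.
by apply: sym_sum_ext (sym_sumD (sB i Pi) IHr) => a b; rewrite big_cons Pi.
Qed.

Let sym_sum1 (f : 'Hom(L, F^o)) (w : L) :
  sym_sum (fun a b => (f a * f b) *: w).
Proof. by exists [:: (f, w)] => a b; rewrite big_seq1. Qed.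

(* On a basis e with coordinate forms c_i, use c_i c_j' + c_j c_i' =
   (c_i + c_j)(c_i' + c_j') - c_i c_i' - c_j c_j'. *)
Lemma sym_decomposition_exists : exists R, has_sym_decomposition R.
Proof.
pose m := \dim {:L}; pose e := vbasis {:L}.
pose c (i : 'I_m) : 'Hom(L, F^o) := linfun (coord e i : L -> F^o).
have cE i a : c i a = coord e i a by rewrite lfunE.
have sumc a : a = \sum_(i < m) c i a *: e`_i.
  rewrite [LHS](coord_vbasis (memvf a)).
  by apply: eq_bigr => i _; rewrite cE.
have polarization (u u' v v' : F) :
    u * v' + u' * v = (u + u') * (v + v') + (- u * v + - u' * v') by ring.
have mulE a b : a * b =
    \sum_(i < m) (c i a * c i b) *: (e`_i * e`_i)
  + \sum_(p : 'I_m * 'I_m | (p.1 < p.2)%N)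
      (((c p.1 + c p.2)%R a * (c p.1 + c p.2)%R b) *: (e`_p.1 * e`_p.2)
       + ((c p.1 a * c p.1 b) *: - (e`_p.1 * e`_p.2)
          + (c p.2 a * c p.2 b) *: - (e`_p.1 * e`_p.2))).
  pose G i j := (c i a * c j b) *: (e`_i * e`_j).
  have ->: a * b = \sum_(p : 'I_m * 'I_m) G p.1 p.2.
    rewrite -(pair_bigA _ G) /= {1}[a]sumc {1}[b]sumc mulr_suml.
    apply: eq_bigr => i _; rewrite mulr_sumr; apply: eq_bigr => j _.
    by rewrite -scalerAr -scalerAl scalerA mulrC.
  rewrite (bigID (fun p : 'I_m * 'I_m => p.1 == p.2)) /=; congr (_ + _).
    rewrite (reindex (fun i : 'I_m => (i, i))) /=; last first.
      by exists fst => [//|[i j]]; rewrite inE /= => /eqP ->.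
    by apply: eq_bigl => i; rewrite eqxx.
  rewrite (bigID (fun p : 'I_m * 'I_m => (p.1 < p.2)%N)) /=.
  have swapE : \sum_(p : 'I_m * 'I_m | (p.1 != p.2) && ~~ (p.1 < p.2)%N)
      G p.1 p.2 = \sum_(p : 'I_m * 'I_m | (p.1 < p.2)%N) G p.2 p.1.
    rewrite (reindex (fun p : 'I_m * 'I_m => (p.2, p.1))) /=; last first.
      by exists (fun p => (p.2, p.1)) => [[]|[]].
    by apply: eq_bigl => -[i j] /=; rewrite -leqNgt ltn_neqAle eq_sym.
  rewrite swapE.
  have ltE : \sum_(p : 'I_m * 'I_m | (p.1 != p.2) && (p.1 < p.2)%N) G p.1 p.2
           = \sum_(p : 'I_m * 'I_m | (p.1 < p.2)%N) G p.1 p.2.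
    by apply: eq_bigl => -[i j] /=; case: eqP => // ->; rewrite ltnn.
  rewrite ltE -big_split; apply: eq_bigr => -[i j] _ /=.
  rewrite /G [e`_j * _]mulrC !add_lfunE !scalerN -!scaleNr -!scalerDl.
  congr (_ *: _).
  exact: polarization.
have [s sP] : sym_sum (fun a b => a * b).
  apply: sym_sum_ext (fun a b => esym (mulE a b)) _.
  apply: sym_sumD; apply: sym_sum_big => i _; first exact: sym_sum1.
  by apply: sym_sumD; [|apply: sym_sumD]; apply: sym_sum1.
exists (size s), (fun i => (tnth (in_tuple s) i).1),
  (fun i => (tnth (in_tuple s) i).2) => a b.
by rewrite sP big_tnth.
Qed.

Lemma sym_rank_subproof :
  exists R, (fun R => `[< has_sym_decomposition R >]) R.
Proof.
by have [R RP] := sym_decomposition_exists; exists R; apply/asboolP.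
Qed.

Definition mu_sym : nat := ex_minn sym_rank_subproof.

Lemma mu_symP :
  has_sym_decomposition mu_sym /\
  forall R, has_sym_decomposition R -> (mu_sym <= R)%N.
Proof.
rewrite /mu_sym; case: ex_minnP => R /asboolP RP minR; split=> // R' /asboolP.
exact: minR.
Qed.

End SymmetricTensorRank.

(* Main.v *)
From HB Require Import structures.
Require Import Defs.
From mathcomp Require Import all_boot all_algebra all_field.
From mathcomp Require Import ring.

Set Implicit Arguments.
Unset Strict Implicit.
Unset Printing Implicit Defensive.

Import GRing.Theory.
Local Open Scope ring_scope.

(** Expand the product of two traces into Frobenius monomials:
      [Tr(c a) Tr(c b) = \sum_(k, l) c^(q^k + q^l) a^(q^k) b^(q^l)].
    Weighting by [w_j] and summing over the points [c = alpha_j], the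
    combination [\sum_j w_j Tr(alpha_j a) Tr(alpha_j b)] is the bilinear
    polynomial whose coefficient at [a^(q^k) b^(q^l)] is
    [\sum_j w_j alpha_j^(q^k + q^l)].  It equals [a b] as soon as this moment
    is 1 for [k = l = 0] and 0 otherwise ([trace_moments_mul]).  The moments are
    symmetric in [k] and [l], so in degree 3 there are six of them, and
    prescribing them is a linear system over the extension field whose matrix is
    the one in the theorem: a nonzero determinant yields the weights, hence a
    symmetric decomposition with the forms [x |-> Tr(alpha_j x)].

    The inclusion of spans is the same identity read through the trace pairing:
    multiplying [a b] by [c] and taking traces gives
      [Tr(b (c a)) = Tr(b \sum_j Tr(c w_j) alpha_j Tr(alpha_j a))] for all [b],
    so that [c a = \sum_j Tr(c w_j) alpha_j Tr(alpha_j a)] with coefficients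
    [Tr(c w_j)] in the base field ([mul_trace_decomposition]).  Nondegeneracy of
    the pairing comes for free: a zero trace would make [1 = 1 * 1] vanish in
    the decomposition. *)

(** * The trace as a linear form over the base field *)

Section TraceForm.
Variables (F : finFieldType) (L : fieldExtType F).
Implicit Types a b c x : L.

Lemma field_trace_is_linear : linear (@field_trace F L).
Proof.
by move=> a x y; have := scaled_trace_is_linear 1 a x y;
  rewrite /scaled_trace !mul1r.
Qed.

HB.instance Definition _ :=
  GRing.isLinear.Build F L L *:%R (@field_trace F L) field_trace_is_linear.

(** Raising to the power [#|F|] shifts the terms of the trace cyclically, since
    [x ^+ (#|F| ^ \dim {:L}) = x]; so the trace is fixed by Frobenius. *)
Lemma field_trace_in_base x : field_trace x \in 1%VS.
Proof.
rewrite Fermat's_little_theorem dimv1 expn1 /field_trace.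
have frobD : {morph (fun y : L => y ^+ #|F|) : y z / y + z}.
  by move=> y z; have := expr_card_linear 1 1 y z; rewrite !scale1r expn1.
have frob0 : (0 : L) ^+ #|F| = 0.
  by rewrite expr0n; have /ltnW/lt0n_neq0/negPf-> := finNzRing_gt1 F.
rewrite (big_morph _ frobD frob0); apply/eqP.
have : (0 < \dim {:L})%N by exact: adim_gt0.
have : x ^+ (#|F| ^ \dim {:L}) == x.
  by rewrite -Fermat's_little_theorem memvf.
case: (\dim {:L}) => // m /eqP xm _.
rewrite big_ord_recr [RHS]big_ord_recl /= expn0 expr1 addrC.
rewrite -exprM mulnC -expnS xm; congr (_ + _).
by apply: eq_bigr => i _; rewrite -exprM mulnC -expnS.
Qed.

(** The trace lies on the line spanned by 1, and its value in [F] is its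
    coordinate on that line. *)
Definition trace_form (c : L) : 'Hom(L, F^o) :=
  (linfun (coord [tuple (1 : L)] ord0 : L -> F^o)
     \o (linfun (@field_trace F L) \o linfun (@amull F L c)))%VF.

Lemma trace_formE c x : (trace_form c x)%:A = field_trace (c * x).
Proof.
rewrite /trace_form !comp_lfunE !lfunE /= lfunE /=.
have: field_trace (c * x) \in <<[tuple (1%R : L)]>>%VS.
  by rewrite span_seq1 field_trace_in_base.
by move/coord_span=> {2}->; rewrite big_ord1.
Qed.

Lemma trace_map_form c x : trace_map c x = trace_form c x *: c.
Proof. by rewrite lfunE /= /scaled_trace -trace_formE mulr_algr. Qed.

End TraceForm.

(** * Decompositions from prescribed moments *)

Section Moments.
Variables (F : finFieldType) (L : fieldExtType F) (n : nat).
Variables (alpha w : 'I_n -> L).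
Hypothesis moments : forall k l, (k < \dim {:L})%N -> (l < \dim {:L})%N ->
  \sum_(j < n) w j * alpha j ^+ (#|F| ^ k + #|F| ^ l)
    = ((k == 0%N) && (l == 0%N))%:R.

(** Both sides are bilinear polynomials in the Frobenius powers of [a] and [b];
    the moments are the coefficients of the right-hand side. *)
Lemma trace_moments_mul a b :
  a * b = \sum_(j < n)
            field_trace (alpha j * a) * field_trace (alpha j * b) * w j.
Proof.
pose mono k l := a ^+ (#|F| ^ k) * b ^+ (#|F| ^ l).
transitivity (\sum_(k < \dim {:L}) \sum_(l < \dim {:L})
    (\sum_(j < n) w j * alpha j ^+ (#|F| ^ k + #|F| ^ l)) * mono k l).
  (* Only [k = l = 0] survives; [z] is the index 0. *)
  pose z : 'I_(\dim {:L}) := Ordinal (adim_gt0 {:L}%AS).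
  under eq_bigr => k _ do under eq_bigr => l _ do rewrite moments //.
  rewrite (bigD1 z) //= [X in _ = _ + X]big1 => [|k kz].
    rewrite addr0 (bigD1 z) //= big1 => [|l lz].
      by rewrite addr0 mul1r /mono expn0 !expr1.
    by rewrite (negPf (lz : val l != 0%N)) mul0r.
  by apply: big1 => l _; rewrite (negPf (kz : val k != 0%N)) mul0r.
under eq_bigr => k _ do under eq_bigr => l _ do rewrite mulr_suml.
under eq_bigr => k _ do rewrite exchange_big.
rewrite exchange_big; apply: eq_bigr => j _ /=.
rewrite /field_trace mulr_suml mulr_suml; apply: eq_bigr => k _.
rewrite mulr_sumr mulr_suml; apply: eq_bigr => l _.
by rewrite /mono !exprMn exprD; ring.
Qed.

Lemma trace_moments_sym_decomposition :
  sym_decomposition (fun j => trace_form (alpha j)) w.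
Proof.
move=> a b; rewrite trace_moments_mul; apply: eq_bigr => j _.
by rewrite -!trace_formE mulr_algl scalerA mulr_algl.
Qed.

(** The decomposition itself forces the trace pairing to be nondegenerate: if
    [x != 0] paired to 0 with everything, all traces would vanish, and so would
    [1 * 1]. *)
Lemma trace_pairing_nondegenerate x :
  (forall b : L, field_trace (b * x) = 0) -> x = 0.
Proof.
move=> tr0; apply/eqP; apply: contraT => x0.
have /eqP := trace_moments_mul 1 1; rewrite mulr1 big1 ?oner_eq0 // => j _.
by rewrite -[alpha j * 1](mulfVK x0) tr0 !mul0r.
Qed.

(** Pairing both sides with [b] gives the trace of [c] times the decomposition
    of [x * b]; the coefficients on the right lie in [F], which is what the
    inclusion of [F]-spans requires. *)
Lemma mul_trace_decomposition c x :
  c * x = \sum_(j < n) trace_form c (w j) *: trace_map (alpha j) x.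
Proof.
apply/eqP; rewrite -subr_eq0; apply/eqP/trace_pairing_nondegenerate => b.
rewrite mulrBr linearB /=; apply/eqP; rewrite subr_eq0; apply/eqP.
rewrite mulrCA [b * x]mulrC (trace_moments_sym_decomposition x b).
rewrite !mulr_sumr !linear_sum; apply: eq_bigr => j _.
rewrite trace_map_form -!scalerAr !linearZ /= [b * _]mulrC -!trace_formE.
by rewrite !scalerA; congr (_ *: _); rewrite mulrC mulrA.
Qed.

Lemma Lspan_x_sub_trace_maps :
  (Lspan_x L <= <<[seq trace_map (alpha j) | j : 'I_n]>>)%VS.
Proof.
apply/subvP => f /Lspan_xP[c fE].
have -> : f = \sum_(j < n) trace_form c (w j) *: trace_map (alpha j).
  apply/lfunP => x; rewrite fE sum_lfunE mul_trace_decomposition.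
  by apply: eq_bigr => j _; rewrite scale_lfunE.
by apply: memv_suml => j _; apply/memvZ/memv_span/image_f.
Qed.

End Moments.

(** * The cubic case *)

Lemma unitmx_solve_delta (K : fieldType) n (A : 'M[K]_n) (i0 : 'I_n) :
  \det A != 0 ->
  exists w : 'I_n -> K, forall i, \sum_j w j * A i j = (i == i0)%:R.
Proof.
move=> detA; have uA : A \in unitmx by rewrite unitmxE unitfE.
exists (fun j => invmx A j i0) => i.
transitivity ((A *m invmx A) i i0); last by rewrite mulmxV // mxE.
by rewrite mxE; apply: eq_bigr => j _; rewrite mulrC.
Qed.

Theorem theorem4p4 (q : nat) (F : finFieldType) (L : fieldExtType F)
  (hq : #|F| = q) (hL : \dim {:L} = 3%N)
  (alpha : 'I_6 -> L) (alpha_neq0 : forall j, alpha j != 0)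
  (hdet :
    \det (\matrix_(i < 6, j < 6)
       [:: alpha j ^+ 2;
           alpha j ^+ (2 * q);
           alpha j ^+ (2 * q ^ 2);
           alpha j ^+ (q + 1);
           alpha j ^+ (q ^ 2 + q);
           alpha j ^+ (q ^ 2 + 1)]`_i) != 0) :
  (mu_sym L <= 6)%N /\
  (exists (phi : 'I_6 -> 'Hom(L, F^o)) (w : 'I_6 -> L),
     (forall j x, (phi j x)%:A = field_trace (alpha j * x)) /\
     sym_decomposition phi w) /\
  (Lspan_x L <= <<[seq trace_map (alpha j) | j : 'I_6]>>)%VS.
Proof.
have [w wP] := unitmx_solve_delta ord0 hdet.
have moments k l : (k < \dim {:L})%N -> (l < \dim {:L})%N ->
    \sum_(j < 6) w j * alpha j ^+ (#|F| ^ k + #|F| ^ l)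
      = ((k == 0%N) && (l == 0%N))%:R.
  (* Row [i] carries the exponent of the pair [(k, l)] or [(l, k)]. *)
  have row i e : (i < 6)%N -> (forall j, [:: alpha j ^+ 2; alpha j ^+ (2 * q);
        alpha j ^+ (2 * q ^ 2); alpha j ^+ (q + 1); alpha j ^+ (q ^ 2 + q);
        alpha j ^+ (q ^ 2 + 1)]`_i = alpha j ^+ e) ->
      \sum_(j < 6) w j * alpha j ^+ e = (i == 0%N)%:R.
    move=> i6 rowE; rewrite -(wP (Ordinal i6)).
    by apply: eq_bigr => j _; rewrite mxE /= rowE.
  rewrite hL hq; case: k => [|[|[|//]]]; case: l => [|[|[|//]]] _ _;
    rewrite ?expn0 ?expn1.
  - exact: (row 0%N).
  - by apply: (row 3%N) => // j; rewrite [in RHS]addnC.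
  - by apply: (row 5%N) => // j; rewrite [in RHS]addnC.
  - exact: (row 3%N).
  - by apply: (row 1%N) => // j; rewrite [in RHS]addnn -mul2n.
  - by apply: (row 4%N) => // j; rewrite [in RHS]addnC.
  - exact: (row 5%N).
  - exact: (row 4%N).
  - by apply: (row 2%N) => // j; rewrite [in RHS]addnn -mul2n.
have dec := trace_moments_sym_decomposition moments.
split; last split.
- by have [_] := mu_symP L; apply; exists (fun j => trace_form (alpha j)), w.
- exists (fun j => trace_form (alpha j)), w; split=> // j x.
  exact: trace_formE.
- exact: Lspan_x_sub_trace_maps moments.
Qed.
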